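(* A nonzero finite-dimensional Lie algebra $L$ over $\mathbb{F}$ is nilpotent if and only if its near perfect radical $NP(L)$ is zero.
   Context: $\mathbb{F}$ denotes either the field of real numbers or the field of complex numbers. An ideal $I$ of $L$ is called a near perfect ideal of $L$ if $[L,I]=I$, where $[L,I]$ is the linear span of all $[x,y]$ with $x\in L$, $y\in I$; the zero ideal is near perfect. The sum of two near perfect ideals is near perfect, so a finite-dimensional Lie algebra $L$ has a largest near perfect ideal (one containing all near perfect ideals of $L$); it is called the near perfect radical of $L$ and denoted $NP(L)$. The lower central series of $L$ is $L^0=L$, $L^{k+1}=[L,L^k]$, and $L$ is nilpotent if $L^m=0$ for some $m$. *)

(* Defs.v *)
From HB Require Import structures.
From mathcomp Require Import all_boot all_order all_algebra.
From mathcomp Require Import boolp classical_sets reals complex.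

Set Implicit Arguments.
Unset Strict Implicit.
Unset Printing Implicit Defensive.

Import Order.TTheory GRing.Theory Num.Theory.
Local Open Scope ring_scope.
Local Open Scope classical_set_scope.

Variant scalars := RealScalars | ComplexScalars.

Definition scalar_field (R : realType) (k : scalars) : fieldType :=
  match k with
  | RealScalars => R : fieldType
  | ComplexScalars => R[i] : fieldType
  end.

(* Finite dimension is part of the Vector structure. *)
HB.mixin Record isLieAlgebra (K : fieldType) L & Vector K L := {
  lie : L -> L -> L;
  lie_linearl : forall z : L, linear (fun x => lie x z);
  lie_linearr : forall z : L, linear (lie z);
  liexx : forall x : L, lie x x = 0;
  lie_jacobi : forall x y z : L,
    lie x (lie y z) + lie y (lie z x) + lie z (lie x y) = 0
}.

#[short(type="lieAlgType")]
HB.structure Definition LieAlgebra (K : fieldType) :=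
  { L of isLieAlgebra K L & Vector K L }.

Section Span.
Variables (K : fieldType) (V : vectType K).
Implicit Types (P : set {vspace V}) (A : set V) (U W : {vspace V}).

Definition is_largest P U := P U /\ forall W, P W -> (W <= U)%VS.

(* Meaningful only when a largest subspace in P exists: the default 0 is returned
   otherwise.  See [linspan_largest] and [NP_largest] for the uses below. *)
Definition largest P : {vspace V} := xget 0%VS (is_largest P).

Lemma is_largest_uniq P U W : is_largest P U -> is_largest P W -> U = W.
Proof.
move=> [PU U1] [PW W1]; apply/eqP.
by rewrite eqEsubv W1 // U1.
Qed.

Lemma largestP P :
  P !=set0 -> (forall U W, P U -> P W -> P (U + W)%VS) -> is_largest P (largest P).
Proof.
move=> [U0 PU0] Padd; apply: (@xgetPex _ 0%VS (is_largest P)).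
pose d n := `[< exists2 U, P U & \dim U = n >].
have dex : exists n, d n by exists (\dim U0); apply/asboolP; exists U0.
have dub n : d n -> (n <= \dim {:V})%N.
  by move/asboolP=> [U _ <-]; rewrite dimvS ?subvf.
case: (ex_maxnP dex dub) => n /asboolP[U PU dU] nmax.
exists U; split=> // W PW.
have dUW : (\dim (U + W) <= \dim U)%N.
  by rewrite dU; apply: nmax; apply/asboolP; exists (U + W)%VS => //; apply: Padd.
have /eqP-> : U == (U + W)%VS by rewrite eqEdim addvSl.
exact: addvSr.
Qed.

(* The linear span of A, as the largest of the spans of finite sequences of
   elements of A. *)
Definition linspan A : {vspace V} :=
  largest [set U | exists2 s : seq V, {in s, forall x, A x} & U = <<s>>%VS].

Lemma linspan_largest A : is_largest
  [set U | exists2 s : seq V, {in s, forall x, A x} & U = <<s>>%VS] (linspan A).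
Proof.
apply: largestP; first by exists <<[::]>>%VS; exists [::].
move=> _ _ [s sA ->] [t tA ->]; exists (s ++ t); last by rewrite span_cat.
by move=> x; rewrite mem_cat => /orP[/sA|/tA].
Qed.

Lemma linspanP A x :
  x \in linspan A <-> exists2 s : seq V, {in s, forall y, A y} & x \in <<s>>%VS.
Proof.
have [[s sA es] ub] := linspan_largest A; split=> [|[t tA xt]].
  by exists s; rewrite -?es.
by apply: subvP xt; apply: ub; exists t.
Qed.

Lemma linspan_sub A W : (linspan A <= W)%VS <-> (forall x, A x -> x \in W).
Proof.
split=> [/subvP AW x Ax|AW].
  apply/AW/linspanP; exists [:: x]; last by rewrite memv_span ?mem_head.
  by move=> y; rewrite inE => /eqP->.
apply/subvP=> x /linspanP[s sA]; apply: subvP; apply/span_subvP=> y /sA.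
exact: AW.
Qed.

End Span.

Section NearPerfect.
Variables (K : fieldType) (L : lieAlgType K).
Implicit Types I J U V : {vspace L}.

Definition lieprod U V : {vspace L} :=
  linspan [set z | exists x y, [/\ x \in U, y \in V & z = lie x y]].

Definition lie_ideal I := forall x y : L, y \in I -> lie x y \in I.

Definition near_perfect I := lie_ideal I /\ lieprod {:L} I = I.

Definition NP : {vspace L} := largest near_perfect.

Fixpoint lower_central (k : nat) : {vspace L} :=
  if k is k'.+1 then lieprod {:L} (lower_central k') else {:L}%VS.

Definition lie_nilpotent := exists m, lower_central m = 0%VS.

Lemma lieprod_sub U V W : (lieprod U V <= W)%VS <->
  (forall x y, x \in U -> y \in V -> lie x y \in W).
Proof.
split=> [/linspan_sub h x y xU yV|h].
  by apply: h; exists x, y.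
by apply/linspan_sub => _ [x [y [xU yV ->]]]; exact: h.
Qed.

Lemma mem_lieprod U V x y : x \in U -> y \in V -> lie x y \in lieprod U V.
Proof. by move=> xU yV; have /lieprod_sub := subvv (lieprod U V); apply. Qed.

Lemma lierD (x y z : L) : lie x (y + z) = lie x y + lie x z.
Proof. by have := lie_linearr x 1 y z; rewrite !scale1r. Qed.

Lemma lier0 (x : L) : lie x 0 = 0.
Proof. by have /eqP := lierD x 0 0; rewrite addr0 -subr_eq subrr => /eqP. Qed.

Lemma lieprodSr U V W : (V <= W)%VS -> (lieprod U V <= lieprod U W)%VS.
Proof.
move=> /subvP VW; apply/lieprod_sub => x y xU /VW yW; exact: mem_lieprod.
Qed.

Lemma near_perfect0 : near_perfect 0%VS.
Proof.
split=> [x y|]; first by rewrite memv0 => /eqP->; rewrite lier0 mem0v.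
apply/eqP; rewrite -subv0; apply/lieprod_sub => x y _.
by rewrite memv0 => /eqP->; rewrite lier0 mem0v.
Qed.

Lemma near_perfectD I J :
  near_perfect I -> near_perfect J -> near_perfect (I + J)%VS.
Proof.
move=> [iI eI] [iJ eJ].
have iIJ : lie_ideal (I + J)%VS.
  move=> x _ /memv_addP[u uI [v vJ ->]].
  by rewrite lierD memv_add ?iI ?iJ.
split=> //; apply/eqP; rewrite eqEsubv; apply/andP; split.
  by apply/lieprod_sub => x y _; exact: iIJ.
rewrite subv_add -{1}eI -{2}eJ.
by rewrite !lieprodSr ?addvSl ?addvSr.
Qed.

Lemma NP_largest : is_largest near_perfect NP.
Proof.
by apply: largestP; [exists 0%VS; exact: near_perfect0 | exact: near_perfectD].
Qed.

End NearPerfect.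
Arguments NP {K} L.
Arguments lower_central {K} L k.
Arguments lie_nilpotent {K} L.

(* Main.v *)
Require Import Defs.
From mathcomp Require Import all_boot all_order all_algebra.
From mathcomp Require Import reals.

(** Both implications compare near perfect ideals with the lower central series.
    A near perfect ideal [I] lies in every term of the series, because
    [I = [L, I]] propagates the inclusion from one term to the next
    ([near_perfect_sub_lower_central]); so a nilpotent algebra has no near perfect
    ideal but zero.  Conversely the series is decreasing, so by finite dimension
    two consecutive terms coincide ([nonincreasing_vspace_stationary]).  The
    repeated term is fixed by bracketing with [L], that is, it is a near perfect
    ideal ([near_perfect_lower_central]), and it vanishes if the near perfect
    radical does. *)

(** Otherwise the dimension would drop at each step, and the term of index
    [1 + \dim (W 0)] would have negative dimension. *)
Lemma nonincreasing_vspace_stationary (K : fieldType) (V : vectType K)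
    (W : nat -> {vspace V}) :
  (forall n, (W n.+1 <= W n)%VS) -> exists n, W n.+1 = W n.
Proof.
move=> Wdecr.
case: (@existsP _ (fun i : 'I_(\dim (W 0)).+1 => W i.+1 == W i)).
  by case=> i /eqP ?; exists i.
move=> noteq; exfalso.
suff dim_drop n : n <= (\dim (W 0)).+1 -> \dim (W n) + n <= \dim (W 0).
  by have := dim_drop _ (leqnn _); rewrite addnS ltnNge leq_addl.
elim: n => [_|n IHn ltn]; first by rewrite addn0.
apply: leq_trans (IHn (ltnW ltn)).
rewrite addnS -addSn leq_add2r ltnNge; apply/negP => dimle.
by apply: noteq; exists (Ordinal ltn); rewrite /= eqEdim Wdecr.
Qed.

Lemma lower_central_decr (K : fieldType) (L : lieAlgType K) (n : nat) :
  (lower_central L n.+1 <= lower_central L n)%VS.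
Proof. by elim: n => [|n IHn]; [exact: subvf | exact: lieprodSr]. Qed.

Lemma lie_ideal_lower_central (K : fieldType) (L : lieAlgType K) (n : nat) :
  lie_ideal (lower_central L n).
Proof.
move=> x y yn; apply: (subvP (lower_central_decr _ L n)).
exact: mem_lieprod (memvf x) yn.
Qed.

Lemma near_perfect_lower_central (K : fieldType) (L : lieAlgType K) (n : nat) :
  lower_central L n.+1 = lower_central L n -> near_perfect (lower_central L n).
Proof. by split; first exact: lie_ideal_lower_central. Qed.

Lemma near_perfect_sub_lower_central (K : fieldType) (L : lieAlgType K)
    (I : {vspace L}) (n : nat) :
  near_perfect I -> (I <= lower_central L n)%VS.
Proof.
move=> [_ LI]; elim: n => [|n IHn]; first exact: subvf.
by rewrite -LI; exact: lieprodSr.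
Qed.

Lemma lie_nilpotent_NP0 (K : fieldType) (L : lieAlgType K) :
  lie_nilpotent L <-> NP L = 0%VS.
Proof.
have [NPnp NPmax] := NP_largest L; split=> [[m Lm0]|NP0].
  apply/eqP; rewrite -subv0 -Lm0.
  exact: near_perfect_sub_lower_central.
have [n /near_perfect_lower_central /NPmax] :=
  nonincreasing_vspace_stationary _ _ _ (lower_central_decr _ L).
by rewrite NP0 subv0 => /eqP Ln0; exists n.
Qed.

Theorem proposition3p2 (R : realType) (k : scalars)
    (L : lieAlgType (scalar_field R k)) :
  {:L}%VS <> 0%VS -> (lie_nilpotent L <-> NP L = 0%VS).
Proof. by move=> _; exact: lie_nilpotent_NP0. Qed.
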